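(* Let $p,d,d_1,d_2$ be positive integers. Let $\boldsymbol{F}:[-1,1]\times[-1,1]\times[0,\infty)\to\mathbb{R}^{p\times p}$ be a continuous mapping such that 1. $\boldsymbol{F}(\cdot,\cdot,\omega)$ is positive definite on $\mathbb{T}^{d_1,d_2}$ for all $\omega\ge0$; 2. $\boldsymbol{F}(0,0,\cdot)$ is pointwise integrable. Let $$\boldsymbol{K}(s,r,h):=\int_{\mathbb{R}^d}\mathrm{e}^{\mathsf{i}\langle\boldsymbol{\omega},\boldsymbol{h}\rangle}\,\boldsymbol{F}(s,r,\|\boldsymbol{\omega}\|)\,\mathrm{d}\boldsymbol{\omega},\qquad s,r\in[-1,1],\ h=\|\boldsymbol{h}\|,\ \boldsymbol{h}\in\mathbb{R}^d.$$ Then $\boldsymbol{K}$ is a positive definite matrix valued function on $\mathbb{T}^{d_1,d_2}\times\mathbb{R}^d$.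
   Context: $\mathbb{S}^{n}$ is the unit sphere of $\mathbb{R}^{n+1}$; $\mathbb{T}^{d_1,d_2}=\mathbb{S}^{d_1}\times\mathbb{S}^{d_2}$; $\langle\cdot,\cdot\rangle$ is the Euclidean dot product and $\|\cdot\|$ the Euclidean norm; $\mathsf{i}$ is the imaginary unit. Continuity and integrability of matrix valued mappings are understood pointwise, that is, entry by entry; integrability of $\boldsymbol{F}(0,0,\cdot)$ refers to the entries of $\boldsymbol{\omega}\mapsto\boldsymbol{F}(0,0,\|\boldsymbol{\omega}\|)$ on $\mathbb{R}^d$. For a nonempty set $X$, a matrix valued function $\boldsymbol{G}:X\times X\to\mathbb{R}^{p\times p}$ is positive definite if $\sum_{k,h=1}^N\boldsymbol{a}_k^\top\boldsymbol{G}(x_k,x_h)\boldsymbol{a}_h\ge0$ for all $N$, all $x_1,\dots,x_N\in X$ and all $\boldsymbol{a}_1,\dots,\boldsymbol{a}_N\in\mathbb{R}^p$. A function $\boldsymbol{K}(s,r,h)$ is called positive definite on $\mathbb{T}^{d_1,d_2}\times\mathbb{R}^d$ if the kernel $\big((x_1,x_2,\mathbf{u}),(x_1',x_2',\mathbf{u}')\big)\mapsto\boldsymbol{K}(\langle x_1,x_1'\rangle,\langle x_2,x_2'\rangle,\|\mathbf{u}-\mathbf{u}'\|)$ is positive definite; a function $\boldsymbol{G}(s,r)$ is called positive definite on $\mathbb{T}^{d_1,d_2}$ if $\big((x_1,x_2),(x_1',x_2')\big)\mapsto\boldsymbol{G}(\langle x_1,x_1'\rangle,\langle x_2,x_2'\rangle)$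 is positive definite.
   Formalization: The formal theorem additionally assumes that the integrals defining K(s,r,h) exist for all s,r in [-1,1] and all h; integrability of F(0,0,·) does not ensure this (e.g. p=1, F = s·r·g(ω) with g ≥ 0 continuous and not integrable). *)

(* Defs.v *)
From HB Require Import structures.
From mathcomp Require Import all_boot all_order all_algebra.
From mathcomp Require Import all_classical all_reals all_analysis.
From mathcomp Require Import complex.

Set Implicit Arguments.
Unset Strict Implicit.
Unset Printing Implicit Defensive.

Import Order.TTheory GRing.Theory Num.Theory.
Import numFieldNormedType.Exports.

Local Open Scope classical_set_scope.
Local Open Scope ring_scope.
Local Open Scope complex_scope.

Definition edot (R : realType) (n : nat) (u v : 'rV[R]_n) : R :=
  \sum_(i < n) u 0 i * v 0 i.

(* The library norm `|u| of a row vector is the sup norm. *)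
Definition enorm (R : realType) (n : nat) (u : 'rV[R]_n) : R :=
  Num.sqrt (edot u u).

Definition sphere (R : realType) (n : nat) : Type :=
  {x : 'rV[R]_n.+1 | enorm x == 1}.

Definition sphere_dot (R : realType) (n : nat) (x y : sphere R n) : R :=
  edot (sval x) (sval y).

(* Not assumed symmetric: only real vectors a_k are tested. *)
Definition posdef_kernel (R : realType) (p : nat) (X : Type)
    (G : X -> X -> 'M[R]_p) : Prop :=
  forall (N : nat) (x : 'I_N -> X) (a : 'I_N -> 'cV[R]_p),
    0 <= (\sum_(k < N) \sum_(h < N) (a k)^T *m G (x k) (x h) *m a h) 0 0.

Definition posdef_torus (R : realType) (p d1 d2 : nat)
    (G : R -> R -> 'M[R]_p) : Prop :=
  posdef_kernel (fun x y : sphere R d1 * sphere R d2 =>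
    G (sphere_dot x.1 y.1) (sphere_dot x.2 y.2)).

Definition posdef_torus_euclid (R : realType) (p d1 d2 d : nat)
    (K : R -> R -> R -> 'M[R]_p) : Prop :=
  posdef_kernel (fun x y : sphere R d1 * sphere R d2 * 'rV[R]_d =>
    K (sphere_dot x.1.1 y.1.1) (sphere_dot x.1.2 y.1.2) (enorm (x.2 - y.2))).

(* Lebesgue measure on R^n, built on n-tuples (which carry the product
   sigma-algebra, unlike row vectors) as the n-fold product of the
   one-dimensional Lebesgue measure. *)
Section lebesgue_cons.
Variables (R : realType) (n : nat).
Variable m : {sigma_finite_measure set (n.-tuple (measurableTypeR R)) -> \bar R}.
Local Open Scope ereal_scope.

Let T := measurableTypeR R.

Definition cons_pair (x : T * n.-tuple T) : n.+1.-tuple T :=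
  [tuple of x.1 :: x.2].

Lemma measurable_cons_pair : measurable_fun setT cons_pair.
Proof.
exact: (@measurable_cons _ _ _ T fst n snd measurable_fst measurable_snd).
Qed.

Definition lebesgue_cons : set (n.+1.-tuple T) -> \bar R :=
  pushforward (@lebesgue_measure R \x m) cons_pair.

Let lebesgue_cons0 : lebesgue_cons set0 = 0.
Proof. by rewrite /lebesgue_cons /pushforward preimage_set0 measure0. Qed.

Let lebesgue_cons_ge0 A : 0 <= lebesgue_cons A.
Proof. by rewrite /lebesgue_cons /pushforward measure_ge0. Qed.

Let lebesgue_cons_sigma_additive : semi_sigma_additive lebesgue_cons.
Proof.
move=> F mF tF mUF; rewrite /lebesgue_cons /pushforward preimage_bigcup.
apply: measure_semi_sigma_additive.
- by move=> k; rewrite -[X in measurable X]setTI; exact: measurable_cons_pair.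
- apply/trivIsetP => /= i j _ _ ij; rewrite -preimage_setI.
  by move/trivIsetP : tF => /(_ _ _ _ _ ij) ->//; rewrite preimage_set0.
- rewrite -preimage_bigcup -[X in measurable X]setTI.
  exact: measurable_cons_pair.
Qed.

HB.instance Definition _ := isMeasure.Build _ _ _ lebesgue_cons
  lebesgue_cons0 lebesgue_cons_ge0 lebesgue_cons_sigma_additive.

Let uncons (t : n.+1.-tuple T) : T * n.-tuple T :=
  (tnth t ord0, [tuple of behead t]).

Let cons_pairK : cancel cons_pair uncons.
Proof. by case=> x t; congr pair; exact: val_inj. Qed.

Let measurable_uncons : measurable_fun setT uncons.
Proof.
apply/measurable_fun_pairP; split.
  exact: (@measurable_tnth _ T n.+1 ord0).
exact: (@measurable_behead _ T n).
Qed.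

Let lebesgue_cons_sigma_finite : sigma_finite setT lebesgue_cons.
Proof.
have /sigma_finiteP[F [TF ndF Foo]] := sigma_finiteT (@lebesgue_measure R).
have /sigma_finiteP[G [TG ndG Goo]] := sigma_finiteT m.
exists (fun k => uncons @^-1` (F k `*` G k)).
  apply/esym; rewrite -subTset => t _.
  have [i _ Fi] : (\bigcup_i F i) (uncons t).1 by rewrite -TF.
  have [j _ Gj] : (\bigcup_i G i) (uncons t).2 by rewrite -TG.
  exists (maxn i j) => //; split.
  - by move: Fi; exact/subsetPset/ndF/leq_maxl.
  - by move: Gj; exact/subsetPset/ndG/leq_maxr.
move=> k; have [mF Fk] := Foo k; have [mG Gk] := Goo k.
have mFG : measurable (F k `*` G k) by exact: measurableX.
split; first by rewrite -[X in measurable X]setTI; exact: measurable_uncons.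
rewrite /lebesgue_cons /pushforward -comp_preimage.
rewrite (_ : uncons \o cons_pair = id); last exact/funext/cons_pairK.
by rewrite preimage_id product_measure1E// lte_mul_pinfty// ge0_fin_numE.
Qed.

HB.instance Definition _ := Measure_isSigmaFinite.Build _ _ _ lebesgue_cons
  lebesgue_cons_sigma_finite.

End lebesgue_cons.

Fixpoint lebesgue_tuple (R : realType) (n : nat) :
    {sigma_finite_measure set (n.-tuple (measurableTypeR R)) -> \bar R} :=
  match n with
  | 0 => \d_([tuple] : 0.-tuple (measurableTypeR R))
  | n'.+1 => lebesgue_cons (lebesgue_tuple R n')
  end.

Definition row_of_tuple (R : realType) (n : nat)
    (t : n.-tuple (measurableTypeR R)) : 'rV[R]_n := \row_(i < n) tnth t i.

Definition integrable_rV (R : realType) (n : nat) (f : 'rV[R]_n -> R) : Prop :=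
  (lebesgue_tuple R n).-integrable setT (fun t => (f (row_of_tuple t))%:E).

Definition integral_rV (R : realType) (n : nat) (f : 'rV[R]_n -> R) : R :=
  \int[lebesgue_tuple R n]_t f (row_of_tuple t).

Definition cintegrable_rV (R : realType) (n : nat) (f : 'rV[R]_n -> R[i]) : Prop :=
  integrable_rV (fun w => complex.Re (f w)) /\
  integrable_rV (fun w => complex.Im (f w)).

Definition cintegral_rV (R : realType) (n : nat) (f : 'rV[R]_n -> R[i]) : R[i] :=
  integral_rV (fun w => complex.Re (f w)) +i*
  integral_rV (fun w => complex.Im (f w)).

Definition expi (R : realType) (x : R) : R[i] := cos x +i* sin x.

Definition fourier_integrand (R : realType) (p d : nat)
    (F : R -> R -> R -> 'M[R]_p) (s r : R) (h : 'rV[R]_d) (i j : 'I_p)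
    (w : 'rV[R]_d) : R[i] :=
  expi (edot w h) * (F s r (enorm w) i j)%:C.

(* Main.v *)
Require Import Defs.
From HB Require Import structures.
From mathcomp Require Import all_boot all_order all_algebra.
From mathcomp Require Import all_classical all_reals all_analysis.
From mathcomp Require Import measurable_realfun complex.
From mathcomp Require Import ring lra.

Set Implicit Arguments.
Unset Strict Implicit.
Unset Printing Implicit Defensive.

Import Order.TTheory GRing.Theory Num.Theory.
Import numFieldNormedType.Exports.

Local Open Scope classical_set_scope.
Local Open Scope ring_scope.
Local Open Scope complex_scope.

(** Write the quadratic form of K as a single integral over w. The phase
    splits as cos <w, u_k - u_h> = cos <w, u_k> cos <w, u_h> +
    sin <w, u_k> sin <w, u_h>, so for each fixed w the integrand is the sum of
    the quadratic forms of F(., ., |w|) at the real vectors cos <w, u_k> a_k and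
    sin <w, u_k> a_k ([posdef_kernel_cos]). Both are nonnegative because
    F(., ., |w|) is positive definite on the product of spheres, and so is the
    integral.

    It remains to see that K is well defined and real: the integral must depend
    on h only through |h|, and its imaginary part must vanish. Both facts come
    from the invariance of Lebesgue measure under orthogonal maps. If |h| = |h'|,
    a Householder reflection Q sends h to h' ([orthogonal_transitive]), and the
    substitution w -> w Q turns one integral into the other ([integral_rV_radial]).
    Taking h' = - h, the sine part equals its own opposite.

    Orthogonal invariance ([ge0_integral_orthogonal]) follows from translation
    invariance and Tonelli alone. Let g be the standard Gaussian density: it has
    integral 1 and is invariant under Q and under x -> - x. Then, each step being
    a translation or an exchange of integrals,
      int f = int_y int_x g(y) f(x)
            = int_y int_x g(y) f(x + y Q)
            = int_x int_y g(y - x Q^T) f(y Q)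
            = int_y f(y Q) int_x g(x - y Q)
            = int_y f(y Q).
    Translation invariance in dimension n reduces to dimension 1 by Tonelli,
    since the measure on n-tuples is built as an iterated product. *)

(** * Translation invariance *)

Section translation.
Variable R : realType.
Local Notation T := (measurableTypeR R).

Lemma measurable_shift (a : R) :
  measurable_fun [set: T] (fun x : R => x + a : T).
Proof. exact: measurable_funD. Qed.

(** Translation preserves the length of half-open intervals, and these lengths
    determine Lebesgue measure. *)
Lemma lebesgue_measure_shift (a : R) (A : set R) : measurable A ->
  lebesgue_measure ((fun x : R => x + a) @^-1` A) = lebesgue_measure A.
Proof.
move=> mA.
pose phi : T -> T := fun x : R => x + a.
have mphi : measurable_fun [set: T] phi := measurable_shift a.
have := @lebesgue_measure_unique R (pushforward (@lebesgue_measure R) phi).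
move=> /(_ mphi) uniq; rewrite [RHS](uniq _ A mA)//.
move=> _ [[x y] _ <-] /=; rewrite /pushforward.
have -> : phi @^-1` `]x, y] = `](x - a), (y - a)]%classic.
  by apply/seteqP; split => z /=; rewrite !in_itv/= ltrBlDr lerBrDr.
rewrite !lebesgue_measure_itv/= !lte_fin ltrD2r.
by case: ifP => // _; rewrite -!EFinB opprB addrA subrK.
Qed.

(** Integration against the image measure of the translation, which is Lebesgue
    measure itself. *)
Lemma ge0_integral_shift (a : R) (f : T -> \bar R) :
  measurable_fun setT f -> (forall x, 0 <= f x)%E ->
  (\int[@lebesgue_measure R]_x f ((x : R) + a)%R = \int[@lebesgue_measure R]_x f x)%E.
Proof.
move=> mf f0; symmetry.
transitivity
  (\int[pushforward (@lebesgue_measure R) (fun x : T => ((x : R) + a)%R : T)]_x f x)%E.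
  apply: eq_measure_integral; first exact: measurable_shift.
  by move=> mshift A mA _; exact/esym/lebesgue_measure_shift.
by rewrite (ge0_integral_pushforward (measurable_shift a)).
Qed.

(** Integrals over n+1 variables become iterated ones, the first variable
    outermost: every induction on the dimension goes through this form. *)
Lemma ge0_integral_lebesgue_cons n (f : n.+1.-tuple T -> \bar R) :
  measurable_fun setT f -> (forall t, 0 <= f t)%E ->
  (\int[lebesgue_tuple R n.+1]_t f t =
   \int[@lebesgue_measure R]_x \int[lebesgue_tuple R n]_t f (cons_pair (x, t)))%E.
Proof.
move=> mf f0.
transitivity (\int[pushforward (@lebesgue_measure R \x lebesgue_tuple R n)
  (@cons_pair R n)]_t f t)%E.
  apply: eq_measure_integral; first exact: measurable_cons_pair.
  by [].
rewrite (ge0_integral_pushforward (@measurable_cons_pair R n))//.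
rewrite preimage_setT fubini_tonelli1// => [|x]; last exact: f0.
exact: measurableT_comp mf (@measurable_cons_pair R n).
Qed.

Definition shift_tuple n (a : 'I_n -> R) (t : n.-tuple T) : n.-tuple T :=
  [tuple (tnth t i : R) + a i : T | i < n].

Lemma measurable_shift_tuple n (a : 'I_n -> R) :
  measurable_fun setT (shift_tuple a).
Proof.
apply/measurable_fun_tnthP => i.
rewrite (_ : _ \o _ = fun t => (tnth t i : R) + a i : T).
  by apply: measurable_funD => //; exact: measurable_tnth.
by apply/funext => t /=; rewrite tnth_mktuple.
Qed.

Lemma shift_tuple_cons n (a : 'I_n.+1 -> R) (x : R) (t : n.-tuple T) :
  shift_tuple a (cons_pair (x : T, t)) =
  cons_pair (x + a ord0 : T, shift_tuple (a \o lift ord0) t).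
Proof.
apply: eq_from_tnth => i; rewrite tnth_mktuple.
have [j ->|->] := unliftP ord0 i; last by [].
by rewrite !tnthS tnth_mktuple.
Qed.

(** Translate the first coordinate in the outer integral and the others, by
    induction, in the inner one. *)
Lemma ge0_integral_shift_tuple n (a : 'I_n -> R) (f : n.-tuple T -> \bar R) :
  measurable_fun setT f -> (forall t, 0 <= f t)%E ->
  (\int[lebesgue_tuple R n]_t f (shift_tuple a t) =
   \int[lebesgue_tuple R n]_t f t)%E.
Proof.
elim: n a f => [|n IH] a f mf f0.
  by apply: eq_integral => t _; rewrite [t]tuple0 [shift_tuple _ _]tuple0.
have mfs := measurableT_comp mf (measurable_shift_tuple a).
rewrite ge0_integral_lebesgue_cons// [RHS]ge0_integral_lebesgue_cons//.
have mfc : measurable_fun setT (f \o @cons_pair R n).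
  exact: measurableT_comp mf (@measurable_cons_pair R n).
rewrite -[RHS](ge0_integral_shift (a ord0)); last 2 first.
- apply: (measurable_fun_fubini_tonelli_F (f \o @cons_pair R n)) => // y.
  exact: f0.
- by move=> x; apply: integral_ge0.
apply: eq_integral => x _.
under eq_integral do rewrite shift_tuple_cons.
rewrite (IH (a \o lift ord0) (fun t => f (cons_pair ((x : R) + a ord0 : T, t))))//.
exact: measurableT_comp mfc (measurable_pair1 _).
Qed.

End translation.

(** * Euclidean geometry of row vectors *)

Section edot_theory.
Variables (R : realType) (n : nat).
Implicit Types u v w : 'rV[R]_n.

Lemma edotE u v : edot u v = (u *m v^T) 0 0.
Proof. by rewrite mxE; apply: eq_bigr => i _; rewrite mxE. Qed.

Lemma edotC u v : edot u v = edot v u.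
Proof. by apply: eq_bigr => i _; rewrite mulrC. Qed.

Lemma edotDl u v w : edot (u + v) w = edot u w + edot v w.
Proof. by rewrite !edotE mulmxDl mxE. Qed.

Lemma edotNl u v : edot (- u) v = - edot u v.
Proof. by rewrite !edotE mulNmx mxE. Qed.

Lemma edotBr u v w : edot u (v - w) = edot u v - edot u w.
Proof. by rewrite !(edotC u) edotDl edotNl. Qed.

Lemma edot_mulmxr (Q : 'M[R]_n) u v :
  Q *m Q^T = 1%:M -> edot (u *m Q) (v *m Q) = edot u v.
Proof. by move=> QQ; rewrite !edotE trmx_mul mulmxA -(mulmxA u) QQ mulmx1. Qed.

Lemma edot_ge0 u : 0 <= edot u u.
Proof. by apply: sumr_ge0 => i _; rewrite -expr2 sqr_ge0. Qed.

Lemma edot_eq0 u : edot u u = 0 -> u = 0.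
Proof.
move=> /eqP; rewrite psumr_eq0 => [/allP u0|i _]; last by rewrite -expr2 sqr_ge0.
apply/rowP => i; rewrite mxE; apply/eqP.
by have := u0 i (mem_index_enum i); rewrite mulf_eq0 orbb.
Qed.

Lemma enorm_ge0 u : 0 <= enorm u.
Proof. exact: sqrtr_ge0. Qed.

Lemma enorm_eq u v : (enorm u = enorm v) <-> (edot u u = edot v v).
Proof.
split=> [|uv]; last by rewrite /enorm uv.
by move/(congr1 (fun x => x ^+ 2)); rewrite /enorm !sqr_sqrtr ?edot_ge0.
Qed.

Lemma enorm_mulmxr (Q : 'M[R]_n) u : Q *m Q^T = 1%:M -> enorm (u *m Q) = enorm u.
Proof. by move=> QQ; apply/enorm_eq; rewrite edot_mulmxr. Qed.

(** The Householder reflection along w = u - v; since |u| = |v|, the vector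
    u - (2 <u, w> / <w, w>) w is exactly u - w = v. *)
Lemma orthogonal_transitive u v : enorm u = enorm v ->
  exists2 Q : 'M[R]_n, Q *m Q^T = 1%:M & u *m Q = v.
Proof.
move=> /enorm_eq uv; have [w wE] : {w | w = u - v} by exists (u - v).
have [w0|wN0] := eqVneq (edot w w) 0.
  exists 1%:M; first by rewrite trmx1 mulmx1.
  by rewrite mulmx1; apply/eqP; rewrite -subr_eq0 -wE; apply/eqP/edot_eq0.
set k := 2 / edot w w.
have dot1 (x y : 'rV[R]_n) : x *m y^T = (edot x y)%:M.
  by rewrite edotE [LHS]mx11_scalar.
exists (1%:M - k *: (w^T *m w)).
  have -> : (1%:M - k *: (w^T *m w))^T = 1%:M - k *: (w^T *m w).
    by rewrite linearB linearZ /= trmx1 trmx_mul trmxK.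
  rewrite mulmxBl mul1mx mulmxBr mulmx1 -scalemxAl -scalemxAr scalerA.
  rewrite -(mulmxA w^T) (mulmxA w) dot1 mul_scalar_mx -scalemxAr scalerA.
  have -> : k * k * edot w w = k + k by rewrite /k; field.
  by rewrite scalerDl opprB addrK subrK.
rewrite mulmxBr mulmx1 -scalemxAr mulmxA dot1 mul_scalar_mx scalerA.
have -> : k * edot u w = 1.
  have ww : edot w w = 2 * edot u w.
    rewrite wE edotDl edotNl !edotBr uv (edotC v u); ring.
  have : 2 * edot u w != 0 by rewrite -ww.
  by rewrite /k ww mulrAC => /divff.
by rewrite scale1r wE subKr.
Qed.

End edot_theory.

(** The two bounds are |x + y|^2 >= 0 and |x - y|^2 >= 0 for unit vectors. *)
Lemma sphere_dot_itv (R : realType) n (x y : sphere R n) : -1 <= sphere_dot x y <= 1.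
Proof.
case: x y => [x x1] [y y1]; rewrite /sphere_dot /=.
have sq (z : 'rV[R]_n.+1) : enorm z == 1 -> edot z z = 1.
  by move=> /eqP z1; rewrite -(sqr_sqrtr (edot_ge0 z)) -/(enorm z) z1 expr1n.
have := edot_ge0 (x + y); have := edot_ge0 (x - y).
rewrite edotBr !edotDl !edotNl edotC !(edotC _ (x + y)) !edotDl !sq// (edotC y x).
by move=> ? ?; apply/andP; split; lra.
Qed.

(** * Orthogonal invariance *)

Section rotation.
Variable R : realType.
Local Notation T := (measurableTypeR R).

Section row_measurability.
Variable n : nat.

Definition tuple_of_row (u : 'rV[R]_n) : n.-tuple T := [tuple u 0 i : T | i < n].

Lemma tuple_of_rowK : cancel tuple_of_row (@row_of_tuple R n).
Proof. by move=> u; apply/rowP => i; rewrite mxE tnth_mktuple. Qed.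

(** The sigma-algebra lives on tuples, not on rows: a row-valued map is called
    measurable when its coordinates are, and a function on rows when its
    composite with [row_of_tuple] is. *)
Definition measurable_row d (X : measurableType d) (u : X -> 'rV[R]_n) :=
  forall i, measurable_fun setT (fun x => u x 0 i : T).

(** The bridge between the two notions of measurability: factor [u] through
    tuples, where measurability is coordinatewise. *)
Lemma measurable_comp_row d (X : measurableType d) (u : X -> 'rV[R]_n)
    (f : 'rV[R]_n -> \bar R) :
  measurable_fun setT (f \o @row_of_tuple R n) -> measurable_row u ->
  measurable_fun setT (f \o u).
Proof.
move=> mf mu; rewrite (_ : f \o u = (f \o @row_of_tuple R n) \o (tuple_of_row \o u)).
  apply: measurableT_comp => //; apply/measurable_fun_tnthP => i.
  rewrite (_ : _ \o _ = fun x => u x 0 i : T); first exact: mu.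
  by apply/funext => x /=; rewrite tnth_mktuple.
by apply/funext => x /=; rewrite tuple_of_rowK.
Qed.

Lemma measurable_row_tuple d (X : measurableType d) (t : X -> n.-tuple T) :
  measurable_fun setT t -> measurable_row (fun x => row_of_tuple (t x)).
Proof.
move=> /measurable_fun_tnthP mt i.
rewrite (_ : (fun x => _) = @tnth n T ^~ i \o t); first exact: mt.
by apply/funext => x; rewrite mxE.
Qed.

Lemma measurable_rowD d (X : measurableType d) (u v : X -> 'rV[R]_n) :
  measurable_row u -> measurable_row v -> measurable_row (fun x => u x + v x).
Proof.
move=> mu mv i; under eq_fun do rewrite mxE.
exact: measurable_funD (mu i) (mv i).
Qed.

Lemma measurable_row_mulmx d (X : measurableType d) (Q : 'M[R]_n) (u : X -> 'rV[R]_n) :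
  measurable_row u -> measurable_row (fun x => u x *m Q).
Proof.
move=> mu i; under eq_fun do rewrite mxE.
apply: measurable_sum => j; apply: measurable_funM => //.
exact: (mu j).
Qed.

End row_measurability.

(** The density is given in product form, which makes its integral computable by
    Tonelli; [gauss_row_edot] gives the radial form, which makes it invariant
    under orthogonal maps. *)
Definition gauss_row n (u : 'rV[R]_n) : R := \prod_(i < n) normal_pdf 0 1 (u 0 i).

Lemma gauss_row_ge0 n (u : 'rV[R]_n) : 0 <= gauss_row u.
Proof. by apply: prodr_ge0 => i _; exact: normal_pdf_ge0. Qed.

Lemma gauss_row_edot n (u : 'rV[R]_n) :
  gauss_row u = normal_peak 1 ^+ n * expR (- (edot u u / 2)).
Proof.
rewrite /gauss_row normal_pdfE ?oner_eq0// big_split/= prodr_const card_ord.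
congr *%R; rewrite /normal_fun -expR_sum /edot mulr_suml -sumrN.
by congr expR; apply: eq_bigr => i _; rewrite subr0 expr1n expr2 mulNr.
Qed.

Lemma measurable_gauss_row n :
  measurable_fun setT (fun t => (gauss_row (@row_of_tuple R n t))%:E).
Proof.
apply/measurable_EFinP/measurable_prod => i _.
under eq_fun do rewrite mxE.
by apply: measurableT_comp (measurable_tnth _); exact: measurable_normal_pdf.
Qed.

Lemma integral_gauss_row n :
  (\int[lebesgue_tuple R n]_t (gauss_row (row_of_tuple t))%:E = 1)%E.
Proof.
elim: n => [|n IH].
  rewrite integral_dirac//=; last exact: measurable_gauss_row.
  by rewrite /dirac indicE in_setT mul1e /gauss_row big_ord0.
rewrite ge0_integral_lebesgue_cons//; first last.
- by move=> t; rewrite lee_fin gauss_row_ge0.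
- exact: measurable_gauss_row.
transitivity (\int[@lebesgue_measure R]_x (normal_pdf 0 1 (x : R))%:E)%E; last first.
  exact: integral_normal_pdf.
apply: eq_integral => x _.
transitivity (\int[lebesgue_tuple R n]_t
  ((normal_pdf 0 1 (x : R))%:E * (gauss_row (row_of_tuple t))%:E))%E.
  apply: eq_integral => t _; rewrite -EFinM; congr EFin.
  rewrite /gauss_row big_ord_recl mxE; congr *%R.
  by apply: eq_bigr => i _; rewrite !mxE tnthS.
rewrite ge0_integralZl//.
- by rewrite IH mule1.
- exact: measurable_gauss_row.
- by move=> t _; rewrite lee_fin gauss_row_ge0.
- by rewrite lee_fin normal_pdf_ge0.
Qed.

Lemma row_of_shift_tuple n (a : 'rV[R]_n) (t : n.-tuple T) :
  row_of_tuple (shift_tuple (a 0) t) = row_of_tuple t + a.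
Proof. by apply/rowP => i; rewrite !mxE tnth_mktuple. Qed.

Lemma ge0_integral_translation n (a : 'rV[R]_n) (f : 'rV[R]_n -> \bar R) :
  measurable_fun setT (f \o @row_of_tuple R n) -> (forall u, 0 <= f u)%E ->
  (\int[lebesgue_tuple R n]_t f (row_of_tuple t + a)%R =
   \int[lebesgue_tuple R n]_t f (row_of_tuple t))%E.
Proof.
move=> mf f0.
rewrite -[RHS](ge0_integral_shift_tuple (a 0) (f := f \o @row_of_tuple R n))//.
  by apply: eq_integral => t _ /=; rewrite row_of_shift_tuple.
by move=> t; exact: f0.
Qed.

Lemma gauss_row_mulmxr n (Q : 'M[R]_n) (u : 'rV[R]_n) :
  Q *m Q^T = 1%:M -> gauss_row (u *m Q) = gauss_row u.
Proof. by move=> QQ; rewrite !gauss_row_edot edot_mulmxr. Qed.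

Lemma gauss_rowN n (u : 'rV[R]_n) : gauss_row (- u) = gauss_row u.
Proof.
rewrite !gauss_row_edot; congr (_ * expR (- (_ / 2))).
by apply: eq_bigr => i _; rewrite mxE mulrNN.
Qed.

(** Averaging the translates of [f] against a Gaussian lets translations move Q
    from one factor to the other, where it is absorbed by the invariance of the
    Gaussian. *)
Lemma ge0_integral_orthogonal n (Q : 'M[R]_n) (f : 'rV[R]_n -> \bar R) :
  Q *m Q^T = 1%:M ->
  measurable_fun setT (f \o @row_of_tuple R n) -> (forall u, 0 <= f u)%E ->
  (\int[lebesgue_tuple R n]_t f (row_of_tuple t *m Q)%R =
   \int[lebesgue_tuple R n]_t f (row_of_tuple t))%E.
Proof.
move=> QQ mf f0; symmetry.
have QTQ : Q^T *m Q = 1%:M by exact: mulmx1C.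
pose row := @row_of_tuple R n; pose g (u : 'rV[R]_n) := (gauss_row u)%:E.
have g0 u : (0 <= g u)%E by rewrite lee_fin gauss_row_ge0.
have mg : measurable_fun setT (g \o row) by exact: measurable_gauss_row.
have intg : (\int[lebesgue_tuple R n]_t g (row t) = 1)%E := integral_gauss_row n.
have mconst d (X : measurableType d) (u : 'rV[R]_n) : measurable_row (fun _ : X => u).
  by move=> i; exact: measurable_cst.
have mid : measurable_row row by exact: measurable_row_tuple.
have mfst : measurable_row (fun z : n.-tuple T * n.-tuple T => row z.1).
  exact: measurable_row_tuple.
have msnd : measurable_row (fun z : n.-tuple T * n.-tuple T => row z.2).
  exact: measurable_row_tuple.
(* Insert the factor 1 = int g, then translate x by y Q. *)
transitivity (\int[lebesgue_tuple R n]_y \int[lebesgue_tuple R n]_x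
    (g (row y) * f (row x + row y *m Q)%R))%E.
  transitivity (\int[lebesgue_tuple R n]_y
      (g (row y) * \int[lebesgue_tuple R n]_x f (row x)))%E.
    rewrite ge0_integralZr//; first by rewrite intg mul1e.
    by apply: integral_ge0 => ? _; exact: f0.
  apply: eq_integral => y _; rewrite -(ge0_integral_translation (row y *m Q))//.
  rewrite -ge0_integralZl//.
  apply: (measurable_comp_row mf); apply: measurable_rowD => //; exact: mconst.
rewrite (fubini_tonelli (fun z => g (row z.1) * f (row z.2 + row z.1 *m Q)%R)%E);
    first last.
- by move=> z; exact: mule_ge0.
- apply: emeasurable_funM; first exact: (measurable_comp_row mg).
  apply: (measurable_comp_row mf); apply: measurable_rowD => //.
  exact: measurable_row_mulmx.
(* Translate y by - x Q^T, the shift that removes x from the argument of f. *)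
transitivity (\int[lebesgue_tuple R n]_x \int[lebesgue_tuple R n]_y
    (g (row y - row x *m Q^T)%R * f (row y *m Q)%R))%E.
  apply: eq_integral => x _.
  rewrite -(ge0_integral_translation (- (row x *m Q^T))
    (f := fun u => g u * f (row x + u *m Q)%R)%E); last 2 first.
  - apply: emeasurable_funM; first exact: (measurable_comp_row mg).
    apply: (measurable_comp_row mf); apply: measurable_rowD; first exact: mconst.
    exact: measurable_row_mulmx.
  - by move=> u; exact: mule_ge0.
  apply: eq_integral => y _; congr (_ * f _)%E.
  by rewrite mulmxDl mulNmx -mulmxA QTQ mulmx1 addrC subrK.
rewrite (fubini_tonelli
  (fun z => g (row z.2 - row z.1 *m Q^T)%R * f (row z.2 *m Q)%R)%E); first last.
- by move=> z; exact: mule_ge0.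
- apply: emeasurable_funM.
    apply: (measurable_comp_row mg); apply: measurable_rowD => //.
    under eq_fun do rewrite -mulmxN.
    exact: measurable_row_mulmx.
  by apply: (measurable_comp_row mf); exact: measurable_row_mulmx.
(* By invariance of g, the inner integral is that of a translate of g. *)
apply: eq_integral => y _.
transitivity (\int[lebesgue_tuple R n]_x (g (row x - row y *m Q)%R * f (row y *m Q)%R))%E.
  apply: eq_integral => x _; congr (_ * _)%E; congr EFin.
  rewrite -(gauss_row_mulmxr _ QQ) mulmxDl mulNmx -mulmxA QTQ mulmx1.
  by rewrite -opprB gauss_rowN.
rewrite ge0_integralZr//.
- by rewrite (ge0_integral_translation (- (row y *m Q)) mg g0) intg mul1e.
- by apply: (measurable_comp_row mg); apply: measurable_rowD => //; exact: mconst.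
Qed.

(** Positive and negative parts of [f] are of the form [s \o f], to which the
    nonnegative case applies. *)
Lemma integral_orthogonal n (Q : 'M[R]_n) (f : 'rV[R]_n -> \bar R) :
  Q *m Q^T = 1%:M -> measurable_fun setT (f \o @row_of_tuple R n) ->
  (\int[lebesgue_tuple R n]_t f (row_of_tuple t *m Q)%R =
   \int[lebesgue_tuple R n]_t f (row_of_tuple t))%E.
Proof.
move=> QQ mf.
have inv (s : \bar R -> \bar R) : measurable_fun setT s -> (forall y, 0 <= s y)%E ->
    (\int[lebesgue_tuple R n]_t s (f (row_of_tuple t *m Q)%R) =
     \int[lebesgue_tuple R n]_t s (f (row_of_tuple t)))%E.
  move=> ms s0; apply: (ge0_integral_orthogonal (f := s \o f)) => //.
    exact: measurableT_comp ms mf.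
  by move=> u; exact: s0.
rewrite integralE [RHS]integralE; congr (_ - _)%E.
- under eq_integral do rewrite funeposE.
  under [RHS]eq_integral do rewrite funeposE.
  apply: (inv (fun y => maxe y 0)); first exact: measurable_maxe.
  by move=> y; rewrite le_max lexx orbT.
- under eq_integral do rewrite funenegE.
  under [RHS]eq_integral do rewrite funenegE.
  apply: (inv (fun y => maxe (- y) 0)%E); first exact: measurable_maxe.
  by move=> y; rewrite le_max lexx orbT.
Qed.

End rotation.

(** * Radial integrals and integrals of quadratic forms *)

Section has_integral.
Variables (R : realType) (n : nat).
Implicit Types (f : 'rV[R]_n -> R).

(** If Q is orthogonal and h Q = h', then the substitution w -> w Q preserves |w|
    and turns <w, h'> = <w, h Q> into <w Q, h Q> = <w, h>. *)
Lemma integral_rV_radial (phi G : R -> R) (h h' : 'rV[R]_n) :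
  enorm h = enorm h' ->
  integrable_rV (fun w => phi (edot w h') * G (enorm w)) ->
  integral_rV (fun w => phi (edot w h) * G (enorm w)) =
  integral_rV (fun w => phi (edot w h') * G (enorm w)).
Proof.
move=> /orthogonal_transitive[Q QQ <-] /integrableP[mf _].
congr fine; rewrite -[RHS](integral_orthogonal QQ (f := fun w =>
  (phi (edot w (h *m Q)) * G (enorm w))%:E) mf).
by apply: eq_integral => t _; rewrite edot_mulmxr// enorm_mulmxr.
Qed.

Definition has_integral f v := integrable_rV f /\ integral_rV f = v.

Lemma has_integralZ f v k : has_integral f v -> has_integral (fun w => k * f w) (k * v).
Proof.
move=> [intf <-]; split; last exact: RintegralZl.
by rewrite /integrable_rV; under eq_fun do rewrite EFinM; exact: integrableZl.
Qed.

Lemma has_integral_sum I (s : seq I) (f : I -> 'rV[R]_n -> R) v :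
  (forall i, has_integral (f i) (v i)) ->
  has_integral (fun w => \sum_(i <- s) f i w) (\sum_(i <- s) v i).
Proof.
move=> intf; split.
  rewrite /integrable_rV; under eq_fun do rewrite -sumEFin.
  by apply: integrable_sum => // i _; have [] := intf i.
have intE i : (\int[lebesgue_tuple R n]_t (f i (row_of_tuple t))%:E = (v i)%:E)%E.
  by have [fi <-] := intf i; rewrite fineK//; exact: integrable_fin_num.
rewrite /integral_rV /Rintegral; under eq_integral do rewrite -sumEFin.
rewrite integral_sum => [|//|i]; last by have [] := intf i.
by under eq_bigr do rewrite intE; rewrite sumEFin.
Qed.

Lemma has_integral_quad p (a b : 'cV[R]_p) (M : 'rV[R]_n -> 'M[R]_p) (V : 'M[R]_p) :
  (forall i j, has_integral (fun w => M w i j) (V i j)) ->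
  has_integral (fun w => (a^T *m M w *m b) 0 0) ((a^T *m V *m b) 0 0).
Proof.
move=> intM.
have quadE (A : 'M[R]_p) :
    (a^T *m A *m b) 0 0 = \sum_j \sum_i (b j 0 * a i 0) * A i j.
  rewrite mxE; apply: eq_bigr => j _; rewrite mxE mulr_suml.
  by apply: eq_bigr => i _; rewrite mxE mulrC mulrA.
rewrite quadE; under eq_fun do rewrite quadE.
by do 2![apply: has_integral_sum => ?]; exact: has_integralZ.
Qed.

End has_integral.

(** By the addition formula the sum is the quadratic form of [G] at the vectors
    cos(theta_k) a_k plus the one at sin(theta_k) a_k. *)
Lemma posdef_kernel_cos (R : realType) p (X : Type) (G : X -> X -> 'M[R]_p)
    (N : nat) (x : 'I_N -> X) (theta : 'I_N -> R) (a : 'I_N -> 'cV[R]_p) :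
  posdef_kernel G ->
  0 <= \sum_(k < N) \sum_(h < N)
    ((a k)^T *m (cos (theta k - theta h) *: G (x k) (x h)) *m a h) 0 0.
Proof.
move=> /(_ N x) Gpos.
have := addr_ge0 (Gpos (fun k => cos (theta k) *: a k))
                 (Gpos (fun k => sin (theta k) *: a k)).
rewrite !summxE -big_split/=; congr (0 <= _); apply: eq_bigr => k _.
rewrite !summxE -big_split/=; apply: eq_bigr => h _.
rewrite cosB ![(_ *: _)^T]linearZ /= -!scalemxAr -!scalemxAl.
by move: (_ *m a h) => q; rewrite !mxE; ring.
Qed.

(** * Positive definiteness of the Fourier transform *)

Lemma Re_fourier_integrand (R : realType) p d (F : R -> R -> R -> 'M[R]_p)
    s r (h : 'rV[R]_d) i j :
  (fun w => complex.Re (fourier_integrand F s r h i j w)) =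
  (fun w => cos (edot w h) * F s r (enorm w) i j).
Proof. by apply/funext => w; rewrite /= mulr0 subr0. Qed.

Lemma Im_fourier_integrand (R : realType) p d (F : R -> R -> R -> 'M[R]_p)
    s r (h : 'rV[R]_d) i j :
  (fun w => complex.Im (fourier_integrand F s r h i j w)) =
  (fun w => sin (edot w h) * F s r (enorm w) i j).
Proof. by apply/funext => w; rewrite /= mulr0 add0r. Qed.

Theorem theorem3p5 (R : realType) (p d d1 d2 : nat)
  (hp : (0 < p)%N) (hd : (0 < d)%N) (hd1 : (0 < d1)%N) (hd2 : (0 < d2)%N)
  (F : R -> R -> R -> 'M[R]_p)
  (Fcont : forall i j : 'I_p,
    {within [set x : R * R * R | [/\ -1 <= x.1.1 <= 1, -1 <= x.1.2 <= 1 & 0 <= x.2]],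
      continuous (fun x : R * R * R => F x.1.1 x.1.2 x.2 i j)})
  (Fposdef : forall w : R, 0 <= w -> posdef_torus d1 d2 (fun s r => F s r w))
  (F00int : forall i j : 'I_p,
    integrable_rV (fun w : 'rV[R]_d => F 0 0 (enorm w) i j))
  (* the integrals defining K exist *)
  (Kint : forall (s r : R) (h : 'rV[R]_d) (i j : 'I_p),
    -1 <= s <= 1 -> -1 <= r <= 1 -> cintegrable_rV (fourier_integrand F s r h i j)) :
  exists K : R -> R -> R -> 'M[R]_p,
    (forall (s r : R) (h : 'rV[R]_d) (i j : 'I_p),
      -1 <= s <= 1 -> -1 <= r <= 1 ->
      (K s r (enorm h) i j)%:C = cintegral_rV (fourier_integrand F s r h i j)) /\
    posdef_torus_euclid d1 d2 d K.
Proof.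
(* K is defined by evaluating the integral at a vector of the prescribed norm,
   here on the first coordinate axis. *)
pose e : 'rV[R]_d := delta_mx 0 (Ordinal hd).
have enorm_e c : 0 <= c -> enorm (c *: e) = c.
  move=> c0; rewrite /enorm edotE linearZ /= -scalemxAl -scalemxAr trmx_delta.
  by rewrite mul_delta_mx scalerA !mxE !eqxx mulr1 -expr2 sqrtr_sqr ger0_norm.
pose K (s r t : R) : 'M[R]_p := \matrix_(i, j)
  integral_rV (fun w => cos (edot w (t *: e)) * F s r (enorm w) i j).
have intcos s r (h : 'rV[R]_d) i j : -1 <= s <= 1 -> -1 <= r <= 1 ->
    has_integral (fun w => cos (edot w h) * F s r (enorm w) i j) (K s r (enorm h) i j).
  move=> s1 r1; have [intRe _] := Kint s r h i j s1 r1.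
  rewrite Re_fourier_integrand in intRe; split=> //; rewrite mxE; symmetry.
  apply: (integral_rV_radial (phi := cos) (G := fun t => F s r t i j)) => //.
  by rewrite enorm_e ?enorm_ge0.
have intsin s r (h : 'rV[R]_d) i j : -1 <= s <= 1 -> -1 <= r <= 1 ->
    integral_rV (fun w => sin (edot w h) * F s r (enorm w) i j) = 0.
  move=> s1 r1; have [_ intIm] := Kint s r h i j s1 r1.
  rewrite Im_fourier_integrand in intIm.
  (* The sine integral is unchanged by h -> - h, which also negates it. *)
  have enormN : enorm (- h) = enorm h.
    by apply/enorm_eq; rewrite edotNl edotC edotNl opprK.
  have := integral_rV_radial (phi := sin) (G := fun t => F s r t i j) enormN intIm.
  have [_] := has_integralZ (-1) (conj intIm erefl).
  under eq_fun => w do rewrite mulN1r -mulNr -sinN edotC -edotNl edotC.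
  by move=> -> /eqP; rewrite mulN1r eqNr => /eqP.
exists K; split=> [s r h i j s1 r1|N x a].
  have [_ intc] := intcos s r h i j s1 r1.
  rewrite /cintegral_rV Re_fourier_integrand Im_fourier_integrand.
  by rewrite intc intsin.
set M := fun k h (w : 'rV[R]_d) => cos (edot w ((x k).2 - (x h).2)) *:
  F (sphere_dot (x k).1.1 (x h).1.1) (sphere_dot (x k).1.2 (x h).1.2) (enorm w).
have intM : has_integral
    (fun w => \sum_(k < N) \sum_(h < N) ((a k)^T *m M k h w *m a h) 0 0)
    ((\sum_(k < N) \sum_(h < N) (a k)^T *m
       K (sphere_dot (x k).1.1 (x h).1.1) (sphere_dot (x k).1.2 (x h).1.2)
         (enorm ((x k).2 - (x h).2)) *m a h) 0 0).
  rewrite summxE; apply: has_integral_sum => k.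
  rewrite summxE; apply: has_integral_sum => h.
  apply: has_integral_quad => i j; rewrite /M; under eq_fun do rewrite mxE.
  by apply: intcos; exact: sphere_dot_itv.
case: intM => _ <-; apply: Rintegral_ge0 => t _.
set w := row_of_tuple t; rewrite /M.
under eq_bigr do under eq_bigr do rewrite edotBr.
apply: (posdef_kernel_cos (G := fun y z : sphere R d1 * sphere R d2 =>
  F (sphere_dot y.1 z.1) (sphere_dot y.2 z.2) (enorm w)) (fun k => (x k).1)).
exact: Fposdef (enorm_ge0 w).
Qed.
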